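(* Let $\mathcal{M}$ be a von Neumann algebra, let $\mathcal{N}_1,\mathcal{N}_2\subseteq\mathcal{M}$ be von Neumann subalgebras, and let $E_i:\mathcal{M}\to\mathcal{N}_i$ be conditional expectations for $i=1,2$. Let $\tilde E_i:=j_i\circ E_i\in\mathrm{CP}(\mathcal{M},\mathcal{M})$, where $j_i:\mathcal{N}_i\hookrightarrow\mathcal{M}$ is the inclusion, and set $\Theta:=\tilde E_1\#\tilde E_2\in\mathrm{CP}(\mathcal{M},\mathcal{M})$. Then: (1) $\Theta$ is an $(\mathcal{N}_1\cap\mathcal{N}_2)$-bimodule map, i.e. $\Theta(axb)=a\Theta(x)b$ for all $a,b\in\mathcal{N}_1\cap\mathcal{N}_2$ and $x\in\mathcal{M}$; (2) $\Theta$ is subunital, i.e. $\Theta(1)\le1$, and $\Theta(1)\in(\mathcal{N}_1\cap\mathcal{N}_2)'\cap\mathcal{M}$.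
   Context: Inclusions of von Neumann algebras are unital. A conditional expectation $E:\mathcal{M}\to\mathcal{N}$ onto a von Neumann subalgebra is a contractive completely positive (CP) linear map with $E(a)=a$ for $a\in\mathcal{N}$ and $E(axb)=aE(x)b$ for $a,b\in\mathcal{N}$, $x\in\mathcal{M}$ (not assumed normal). $\mathrm{CP}(\mathcal{M},\mathcal{N})$ is the set of all CP maps $\mathcal{M}\to\mathcal{N}$. Forms: for a complex vector space $\mathcal{V}$ and positive sesquilinear forms $\alpha,\beta$ on $\mathcal{V}$ (linear in the first variable), a compatible representation consists of a linear map $h$ from $\mathcal{V}$ onto a dense subspace of a Hilbert space $\mathcal{H}$ and commuting positive $A,B\in\mathbb{B}(\mathcal{H})$ with $\alpha(x,y)=\langle Ah(x),h(y)\rangle$, $\beta(x,y)=\langle Bh(x),h(y)\rangle$. By Pusz–Woronowicz such representations always exist and the form $(\alpha\#\beta)(x,y):=\langle\sqrt{AB}\,h(x),h(y)\rangle$ does not depend on the choice. CP maps: $L^2(\mathcal{N})$ is the standard form Hilbert space of $\mathcal{N}$. For $\Phi\in\mathrm{CP}(\mathcal{M},\mathcal{N})$, $s_\Phi$ is the positive sesquilinear form on the algebraic tensor product $\mathcal{M}\odot L^2(\mathcal{N})$ given by $s_\Phi(x\otimes\xi,y\otimes\eta)=\langle\Phi(y^*x)\xi,\eta\rangle$. The geometric mean $\Phi\#\Psi\in\mathrm{CP}(\mathcal{M},\mathcal{N})$ is the unique CP map with $\langle(\Phi\#\Psi)(y^*x)\xi,\eta\rangle=(s_\Phi\#s_\Psi)(x\otimes\xi,y\otimes\eta)$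 for all $x,y\in\mathcal{M}$, $\xi,\eta\in L^2(\mathcal{N})$. (Here it is applied with $\mathcal{N}=\mathcal{M}$.) *)

(* Defs.v *)
From HB Require Import structures.
From mathcomp Require Import all_boot all_order all_algebra complex.
From mathcomp Require Import all_classical all_reals all_analysis.

Set Implicit Arguments.
Unset Strict Implicit.
Unset Printing Implicit Defensive.

Import Order.TTheory GRing.Theory Num.Theory numFieldNormedType.Exports.

Local Open Scope classical_set_scope.
Local Open Scope ring_scope.

(* Complex Hilbert spaces. Inner products and sesquilinear forms are linear in
   the first variable; 0 <= z in R[i] means that z is real and nonnegative. *)
HB.mixin Record CompleteNormedModule_isHilbert (R : realType) H
    of CompleteNormedModule R[i] H := {
  inner : {dot H for (@Num.conj R[i])} ;
  inner_norm : forall x : H, inner x x = `|x| ^+ 2 }.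

#[short(type="hilbertType")]
HB.structure Definition Hilbert (R : realType) :=
  {H of CompleteNormedModule R[i] H & CompleteNormedModule_isHilbert R H}.


(* Operators are plain functions H -> H. These form an lmodType R[i] pointwise;
   the product is composition, the unit is idfun, and sets of operators are
   classical sets. *)
Section Operators.
Variables (R : realType) (H : hilbertType R).
Implicit Types (T S : H -> H) (A M : set (H -> H)).

Definition bounded_operator T :=
  linear T /\ exists c : R, forall x : H, `|T x| <= c%:C%C * `|x|.

Definition is_adjoint T S := forall x y : H, inner (T x) y = inner x (S y).

Definition positive_operator T := forall x : H, 0 <= inner (T x) x.

Definition operator_le S T := positive_operator (T - S).

Definition opnorm T : R :=
  sup [set complex.Re `|T x| | x in [set x : H | `|x| <= 1]].

Definition is_sqrt T S :=
  [/\ bounded_operator S, positive_operator S & S \o S = T].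

Definition commutant A : set (H -> H) :=
  [set T | bounded_operator T /\ forall S, A S -> T \o S = S \o T].

(* The bicommutant condition makes M a unital subalgebra of B(H); the inclusion
   of one von Neumann algebra of operators on H in another is thus unital. *)
Record von_neumann_algebra M : Prop := {
  vna_bounded : M `<=` bounded_operator ;
  vna_adjoint : forall T, M T -> exists2 S, M S & is_adjoint T S ;
  vna_bicommutant : commutant (commutant M) = M }.

(* Positivity, as an operator on H ^ n, of an n x n matrix of operators. *)
Definition positive_opmx n (X : 'M[H -> H]_n) :=
  forall xi : 'I_n -> H, 0 <= \sum_i \sum_j inner (X i j (xi j)) (xi i).

(* A standard form (M, H, J, P) in the sense of Haagerup. *)
Record standard_form M (J : H -> H) (P : set H) : Prop := {
  sf_antilinear : forall (a : R[i]) x y, J (a *: x + y) = a^* *: J x + J y ;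
  sf_isometry : forall x, `|J x| = `|x| ;
  sf_involution : forall x, J (J x) = x ;
  sf_self_dual : P = [set x | forall y, P y -> 0 <= inner x y] ;
  sf_commutant : [set J \o T \o J | T in M] = commutant M ;
  sf_center : forall c d,
    M c -> commutant M c -> is_adjoint c d -> J \o c \o J = d ;
  sf_fix : forall x, P x -> J x = x ;
  sf_cone : forall a x, M a -> P x -> P (a (J (a (J x)))) }.

End Operators.

(* Maps between von Neumann algebras M and N are functions on all operators of
   which only the values on M matter. When N is contained in M, the composite of
   E : M -> N with the inclusion of N in M is given by the same function E. *)
Section Maps.
Variables (R : realType) (H K : hilbertType R).
Implicit Types (M : set (H -> H)) (N : set (K -> K)).
Implicit Types (Phi : (H -> H) -> (K -> K)).

Definition linear_on M Phi := forall (a : R[i]) (x y : H -> H),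
  M x -> M y -> Phi (a *: x + y) = a *: Phi x + Phi y.

Record completely_positive M N Phi : Prop := {
  cp_maps : forall x, M x -> N (Phi x) ;
  cp_linear : linear_on M Phi ;
  cp_positive : forall n (X : 'M[H -> H]_n), (forall i j, M (X i j)) ->
    positive_opmx X -> positive_opmx (map_mx Phi X) }.

Record star_isomorphism M N Phi : Prop := {
  iso_linear : linear_on M Phi ;
  iso_mul : forall x y, M x -> M y -> Phi (x \o y) = Phi x \o Phi y ;
  iso_adjoint : forall x y,
    M x -> M y -> is_adjoint x y -> is_adjoint (Phi x) (Phi y) ;
  iso_inj : forall x y, M x -> M y -> Phi x = Phi y -> x = y ;
  iso_image : Phi @` M = N }.

(* pi is the action of M on its standard form Hilbert space K = L^2(M). *)
Definition standard_representation M (pi : (H -> H) -> (K -> K)) :=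
  exists (N : set (K -> K)) (J : K -> K) (P : set K),
    [/\ von_neumann_algebra N, star_isomorphism M N pi & standard_form N J P].

End Maps.

Record conditional_expectation (R : realType) (H : hilbertType R)
    (M N : set (H -> H)) (E : (H -> H) -> (H -> H)) : Prop := {
  ce_cp : completely_positive M N E ;
  ce_contractive : forall x, M x -> opnorm (E x) <= opnorm x ;
  ce_id : forall a, N a -> E a = a ;
  ce_bimodule : forall a x b, N a -> M x -> N b ->
    E (a \o x \o b) = a \o E x \o b }.

Notation sesquilinear R V :=
  {bilinear V -> V -> R[i] | *%R & (@Num.conj R[i] \; *%R)}.

Section FormGeometricMean.
Variables (R : realType) (V : lmodType R[i]).

Definition positive_form (a : V -> V -> R[i]) := forall v, 0 <= a v v.

Record compatible_representation (a b : V -> V -> R[i])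
    (K : hilbertType R) (h : V -> K) (A B : K -> K) : Prop := {
  cr_linear : linear h ;
  cr_dense : dense (range h) ;
  cr_boundedA : bounded_operator A ;
  cr_boundedB : bounded_operator B ;
  cr_positiveA : positive_operator A ;
  cr_positiveB : positive_operator B ;
  cr_commute : A \o B = B \o A ;
  cr_formA : forall x y, a x y = inner (A (h x)) (h y) ;
  cr_formB : forall x y, b x y = inner (B (h x)) (h y) }.

Definition is_form_geometric_mean (a b c : V -> V -> R[i]) :=
  exists (K : hilbertType R) (h : V -> K) (A B S : K -> K),
    [/\ compatible_representation a b h A B, is_sqrt (A \o B) S &
        forall x y, c x y = inner (S (h x)) (h y)].

End FormGeometricMean.

(* (V, t) is the algebraic tensor product of the linear subspace M of U with L,
   through its universal property. *)
Section TensorProduct.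
Variables (F : fieldType) (U L : lmodType F) (M : set U).

Definition bilinear_on (V : lmodType F) (t : U -> L -> V) :=
  (forall a x y xi, M x -> M y -> t (a *: x + y) xi = a *: t x xi + t y xi) /\
  (forall x, M x -> linear (t x)).

Definition is_tensor_product (V : lmodType F) (t : U -> L -> V) :=
  bilinear_on t /\
  forall (W : lmodType F) (b : U -> L -> W), bilinear_on b ->
    exists! f : V -> W,
      linear f /\ forall x xi, M x -> f (t x xi) = b x xi.

End TensorProduct.

Section CPGeometricMean.
Variables (R : realType) (H K L : hilbertType R).
Variables (M : set (H -> H)) (N : set (K -> K)).
(* pi represents N on L = L^2(N). *)
Variable pi : (K -> K) -> (L -> L).
Implicit Types (Phi Psi Theta : (H -> H) -> (K -> K)).

(* The form s is s_Phi, on the tensor product (V, t) of M and L. *)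
Definition is_cp_form (V : lmodType R[i]) (t : (H -> H) -> L -> V)
    Phi (s : sesquilinear R V) :=
  positive_form s /\
  forall x y ystar xi eta, M x -> M y -> is_adjoint y ystar ->
    s (t x xi) (t y eta) = inner (pi (Phi (ystar \o x)) xi) eta.

(* Theta is the geometric mean Phi # Psi, given by its defining property, which
   determines Theta on M. *)
Definition is_cp_geometric_mean Phi Psi Theta :=
  completely_positive M N Theta /\
  exists (V : lmodType R[i]) (t : (H -> H) -> L -> V)
      (sPhi sPsi s : sesquilinear R V),
    [/\ is_tensor_product M t, is_cp_form t Phi sPhi, is_cp_form t Psi sPsi,
        is_form_geometric_mean sPhi sPsi s & is_cp_form t Theta s].

End CPGeometricMean.

(* Main.v *)
(** Let [a] lie in [N1], and let [v = xa (x) xi - x (x) a xi]. The form of [E1]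
    vanishes at [(v, v)] because [E1] is a right [N1]-module map. In a compatible
    representation this says [A h v = 0], so [sqrt (AB) h v = 0] and the form of
    [Theta] vanishes on [v] in either variable, which says that [Theta] is a right
    and a left [N1]-module map; in particular [Theta 1] commutes with [N1].

    For subunitality, [sqrt (AB) <= (A + B) / 2] for commuting positive [A] and
    [B], by operator monotonicity of the square root. At the vectors [1 (x) xi]
    this gives [pi (Theta 1) <= 1]. Since the inverse of a coercive operator lies
    in its bicommutant, the isomorphism [pi] reflects positivity. *)

Require Import Defs.
From HB Require Import structures.
From mathcomp Require Import all_boot all_order all_algebra complex.
From mathcomp Require Import all_classical all_reals all_analysis.
From mathcomp Require Import ring lra.

Set Implicit Arguments.
Unset Strict Implicit.
Unset Printing Implicit Defensive.

Import Order.TTheory GRing.Theory Num.Theory numFieldNormedType.Exports.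

Local Open Scope classical_set_scope.
Local Open Scope ring_scope.

(** * The real part of the inner product and the real-valued norm *)

Lemma Re_mul_real (R : rcfType) (a : R) (z : R[i]) :
  complex.Re (a%:C%C * z) = a * complex.Re z.
Proof. by case: z => u v; simpc. Qed.

Lemma Re_conj (R : rcfType) (z : R[i]) : complex.Re z^* = complex.Re z.
Proof. by case: z. Qed.

Section RealInnerProduct.
Variables (R : realType) (H : hilbertType R).
Implicit Types (x y z : H) (a : R).

(** Real parts suffice: they determine a vector, by [rdot_eq], and turn operator estimates into real
    arithmetic. *)
Definition rdot x y : R := complex.Re (inner x y).

Definition rnorm x : R := complex.Re `|x|.

Lemma rnormE x : `|x| = (rnorm x)%:C%C.
Proof. by rewrite /rnorm RRe_real // normr_real. Qed.

Lemma rdotDl x y z : rdot (x + y) z = rdot x z + rdot y z.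
Proof. by rewrite /rdot linearDl raddfD. Qed.

Lemma rdotBl x y z : rdot (x - y) z = rdot x z - rdot y z.
Proof. by rewrite /rdot linearBl raddfB. Qed.

Lemma rdotDr x y z : rdot z (x + y) = rdot z x + rdot z y.
Proof. by rewrite /rdot linearDr raddfD. Qed.

Lemma rdotBr x y z : rdot z (x - y) = rdot z x - rdot z y.
Proof. by rewrite /rdot linearBr raddfB. Qed.

Lemma rdotZl a x y : rdot (a%:C%C *: x) y = a * rdot x y.
Proof.
rewrite /rdot linearZl_LR; exact: Re_mul_real.
Qed.

Lemma rdotC x y : rdot x y = rdot y x.
Proof. by rewrite /rdot hermC expr0 mul1r; exact: Re_conj. Qed.

Lemma rdotZr a x y : rdot x (a%:C%C *: y) = a * rdot x y.
Proof. by rewrite rdotC rdotZl rdotC. Qed.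

Lemma rdot0l y : rdot 0 y = 0.
Proof. by rewrite /rdot linear0l. Qed.

Lemma rdot0r y : rdot y 0 = 0.
Proof. by rewrite rdotC rdot0l. Qed.

Lemma rdotxx x : rdot x x = rnorm x ^+ 2.
Proof. by rewrite /rdot inner_norm rnormE !expr2; exact: Re_mul_real. Qed.

Lemma rnorm_ge0 x : 0 <= rnorm x.
Proof. by rewrite -lecR -rnormE normr_ge0. Qed.

Lemma rnorm_eq0 x : (rnorm x == 0) = (x == 0).
Proof. by rewrite -[RHS]normr_eq0 rnormE -(inj_eq (@complexI R)). Qed.

Lemma rnormZ a x : rnorm (a%:C%C *: x) = `|a| * rnorm x.
Proof.
apply: complexI; rewrite -rnormE normrZ rnormE rmorphM; congr (_ * _).
by rewrite normc_def /= expr0n addr0 sqrtr_sqr.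
Qed.

Lemma rnormN x : rnorm (- x) = rnorm x.
Proof. by rewrite /rnorm normrN. Qed.

Lemma rnormD x y : rnorm (x + y) <= rnorm x + rnorm y.
Proof.
rewrite -lecR [leRHS](rmorphD (real_complex R)) /= -![(rnorm _)%:C%C]rnormE.
exact: ler_normD.
Qed.

Lemma rdot_eq x y : (forall z, rdot x z = rdot y z) -> x = y.
Proof.
move=> xy; apply/eqP; rewrite -subr_eq0 -rnorm_eq0 -sqrf_eq0 -rdotxx.
by rewrite rdotBl xy subrr.
Qed.

End RealInnerProduct.

(** * Bounded operators and the Cauchy-Schwarz inequality of a positive operator *)

Lemma sqr_le_of_quad_ge0 (R : realFieldType) (a b c : R) :
  0 <= a -> 0 <= c -> (forall t, 0 <= a + 2 * t * b + t ^+ 2 * c) -> b ^+ 2 <= a * c.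
Proof.
move=> a0; rewrite le_eqVlt => /orP[/eqP <- q|c0 q].
  have [->|b0] := eqVneq b 0; first by rewrite expr0n /= mulr0.
  (* When [c = 0] the polynomial is affine in [t], and this [t] gives it the value [-1]. *)
  have := q (- (a + 1) / (2 * b)).
  have -> : a + 2 * (- (a + 1) / (2 * b)) * b + (- (a + 1) / (2 * b)) ^+ 2 * 0 = - 1.
    by field.
  by rewrite lerNr oppr0 ler10.
(* The polynomial is smallest at this [t]. *)
have := q (- b / c).
have -> : a + 2 * (- b / c) * b + (- b / c) ^+ 2 * c = a - b ^+ 2 / c.
  by field; rewrite gt_eqF.
by rewrite subr_ge0 ler_pdivrMr.
Qed.

Section BoundedOperators.
Variables (R : realType) (H : hilbertType R).
Implicit Types (x y z : H) (a c : R) (S T P : H -> H).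

(** For a complex linear [T] this is full selfadjointness: replacing [x] by ['i *: x] recovers the
    imaginary parts. *)
Definition selfadjoint T := forall x y, rdot (T x) y = rdot x (T y).

Lemma bounded_linear T : bounded_operator T -> linear T.
Proof. by case. Qed.

Lemma bounded_rnorm T : bounded_operator T ->
  exists2 c : R, 0 < c & forall x, rnorm (T x) <= c * rnorm x.
Proof.
move=> [_ [c Tc]]; exists (`|c| + 1); first by rewrite ltr_wpDl.
move=> x; have := Tc x; rewrite !rnormE -rmorphM lecR => /le_trans; apply.
by rewrite ler_wpM2r ?rnorm_ge0 // (le_trans (ler_norm c)) // lerDl.
Qed.

Lemma rnorm_bounded T c : linear T -> (forall x, rnorm (T x) <= c * rnorm x) ->
  bounded_operator T.
Proof.
by move=> linT Tc; split=> //; exists c => x; rewrite !rnormE -rmorphM lecR.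
Qed.

Lemma linear_opD T x y : linear T -> T (x + y) = T x + T y.
Proof. by move=> linT; have := linT 1 x y; rewrite !scale1r. Qed.

Lemma linear_op0 T : linear T -> T 0 = 0.
Proof. by move=> linT; apply: (addrI (T 0)); rewrite -linear_opD // !addr0. Qed.

Lemma linear_opZ T k x : linear T -> T (k *: x) = k *: T x.
Proof. by move=> linT; rewrite -[k *: x]addr0 linT linear_op0 // addr0. Qed.

Lemma linear_opB T x y : linear T -> T (x - y) = T x - T y.
Proof.
by move=> linT; rewrite -scaleN1r linear_opD // linear_opZ // scaleN1r.
Qed.

Lemma bounded_comp S T : bounded_operator S -> bounded_operator T ->
  bounded_operator (S \o T).
Proof.
move=> bS bT; have [c c0 Sc] := bounded_rnorm bS; have [d d0 Td] := bounded_rnorm bT.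
apply: (@rnorm_bounded _ (c * d)) => [k x y|x] /=.
  by rewrite (bounded_linear bT) (bounded_linear bS).
by rewrite (le_trans (Sc _)) // -mulrA ler_pM2l.
Qed.

Lemma bounded_lincomb k S T : bounded_operator S -> bounded_operator T ->
  bounded_operator (k *: S + T).
Proof.
move=> bS bT; have [_ [c Sc]] := bS; have [_ [d Td]] := bT.
have normk : `|k| = (complex.Re `|k|)%:C%C by rewrite RRe_real // normr_real.
split=> [l x y|].
  change (k *: S (l *: x + y) + T (l *: x + y) =
    l *: (k *: S x + T x) + (k *: S y + T y)).
  rewrite (bounded_linear bS) (bounded_linear bT) !scalerDr !scalerA [k * l]mulrC.
  by rewrite addrACA.
exists (complex.Re `|k| * c + d) => x; rewrite [(_ + _) x]/(k *: S x + T x).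
rewrite (le_trans (ler_normD _ _)) // [X in X * _](rmorphD (real_complex R)) /=.
rewrite [X in (X + _) * _](rmorphM (real_complex R)) /= -[X in X * _ + _]normk.
rewrite mulrDl lerD //.
by rewrite normrZ -mulrA ler_wpM2l.
Qed.

Lemma bounded_id : bounded_operator (@idfun H).
Proof. by split=> //; exists 1 => x; rewrite mul1r. Qed.

Lemma bounded_sub S T : bounded_operator S -> bounded_operator T ->
  bounded_operator (S - T).
Proof.
by move=> bS bT; rewrite addrC -scaleN1r; apply: bounded_lincomb.
Qed.

Lemma positive_rdot T x : positive_operator T -> 0 <= rdot (T x) x.
Proof. by move=> /(_ x); rewrite /rdot lecE => /andP[]. Qed.

(* Polarization: [inner (T z) z] is real at [z = x + y] and [z = x + 'i *: y]. *)
Lemma positive_selfadjoint T : linear T -> positive_operator T -> selfadjoint T.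
Proof.
move=> linT posT x y; rewrite [RHS]rdotC /rdot.
have ImT z : complex.Im (inner (T z) z) = 0 by apply: ger0_Im.
have := ImT (x + 'i%C *: y).
rewrite linear_opD // linear_opZ // !(linearDl, linearDr) linearZl_LR linearZr_LR /=.
rewrite linearZl_LR linearZr_LR /=.
move: (ImT x) (ImT y); case: (inner (T x) x) => ? ?; case: (inner (T y) y) => ? ?.
case: (inner (T x) y) => ? ?; case: (inner (T y) x) => ? ? /= -> ->.
by lra.
Qed.

Lemma positive_cauchy_schwarz P x y : linear P -> selfadjoint P ->
  (forall z, 0 <= rdot (P z) z) ->
  rdot (P x) y ^+ 2 <= rdot (P x) x * rdot (P y) y.
Proof.
move=> linP saP P0; apply: sqr_le_of_quad_ge0 => // t.
have := P0 (x + t%:C%C *: y).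
rewrite linear_opD // linear_opZ // !(rdotDl, rdotDr, rdotZl, rdotZr).
rewrite [rdot (P y) x]saP [rdot y _]rdotC.
by congr (0 <= _); ring.
Qed.

Lemma cauchy_schwarz x y : rdot x y <= rnorm x * rnorm y.
Proof.
rewrite (le_trans (ler_norm _)) // -(@ler_pXn2r _ 2) ?nnegrE //; last first.
  by rewrite mulr_ge0 ?rnorm_ge0.
rewrite real_normK ?num_real // exprMn -!rdotxx.
by apply: (@positive_cauchy_schwarz idfun) => // z; rewrite /= rdotxx sqr_ge0.
Qed.

(** The Cauchy-Schwarz inequality of [P] at [x] and [P x] bounds [rnorm (P x) ^+ 4] by
    [rdot (P x) x * (c * rnorm (P x) ^+ 2)]. Thus a vector that is nearly null for the form of [P]
    is nearly killed by [P]. *)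
Lemma rnorm_positive_le P : bounded_operator P -> selfadjoint P ->
  (forall z, 0 <= rdot (P z) z) ->
  exists2 c : R, 0 < c & forall x, rnorm (P x) ^+ 2 <= c * rdot (P x) x.
Proof.
move=> bP saP P0; have [c c0 Pc] := bounded_rnorm bP; exists c => // x.
have := positive_cauchy_schwarz x (P x) (bounded_linear bP) saP P0.
have [->|Px0] := eqVneq (P x) 0.
  by move=> _; rewrite rdot0l mulr0 -rdotxx rdot0l.
have n0 : 0 < rnorm (P x) by rewrite lt_def rnorm_eq0 Px0 rnorm_ge0.
rewrite rdotxx => le1.
have le2 : rdot (P (P x)) (P x) <= c * rnorm (P x) ^+ 2.
  by rewrite (le_trans (cauchy_schwarz _ _)) // expr2 mulrA ler_pM2r.
rewrite -(@ler_pM2r _ (rnorm (P x) ^+ 2)) ?exprn_gt0 // -expr2.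
rewrite (le_trans le1) // [c * _]mulrC -mulrA ler_wpM2l //.
Qed.

Lemma positive_eq0 P x : bounded_operator P -> positive_operator P ->
  rdot (P x) x = 0 -> P x = 0.
Proof.
move=> bP posP Px0; have saP := positive_selfadjoint (bounded_linear bP) posP.
have [c c0 /(_ x)] := rnorm_positive_le bP saP (fun z => positive_rdot z posP).
rewrite Px0 mulr0 => le0; apply/eqP; rewrite -rnorm_eq0 -sqrf_eq0 eq_le le0.
exact: sqr_ge0.
Qed.

End BoundedOperators.

(** * Operator inequalities and the arithmetic-geometric mean *)

Section OrderOfOperators.
Variables (R : realType) (H : hilbertType R).
Implicit Types (x y z : H) (a c : R) (S T P : H -> H).

Lemma bounded_add S T : bounded_operator S -> bounded_operator T ->
  bounded_operator (S + T).
Proof. by move=> bS bT; rewrite -[S]scale1r; apply: bounded_lincomb. Qed.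

Lemma bounded_scale k T : bounded_operator T -> bounded_operator (k *: T).
Proof.
move=> bT; rewrite -[k *: T]addr0; apply: bounded_lincomb => //.
split=> [l x y|]; first by rewrite -[RHS]/(l *: (0 : H) + 0) scaler0 addr0.
by exists 0 => x; rewrite -[`|_|]/(`|0 : H|) normr0 mul0r.
Qed.

(** Let [l] be the supremum of [rdot (T x) x] over unit vectors. Then [l - T] is positive, and by
    [rnorm_positive_le] it nearly kills any unit vector that nearly attains the supremum. *)
Lemma approximate_eigenvector T x0 : bounded_operator T -> selfadjoint T ->
  0 < rdot (T x0) x0 ->
  exists2 l : R, 0 < l & forall d : R, 0 < d ->
    exists2 x, rnorm x = 1 & rnorm (T x - l%:C%C *: x) <= d.
Proof.
move=> bT saT q0; have linT := bounded_linear bT.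
have [c c0 Tc] := bounded_rnorm bT.
pose E := [set rdot (T x) x | x in [set x | rnorm x = 1]].
have unitE x : x != 0 -> E (rdot (T x) x / rnorm x ^+ 2).
  move=> x0'; have nx : 0 < rnorm x by rewrite lt_def rnorm_eq0 x0' rnorm_ge0.
  exists (((rnorm x)^-1)%:C%C *: x) => /=.
    by rewrite rnormZ ger0_norm ?invr_ge0 ?rnorm_ge0 // mulVf // gt_eqF.
  rewrite linear_opZ // rdotZl rdotZr mulrA mulrC; congr (_ * _).
  by rewrite -exprVn expr2.
have x0N0 : x0 != 0.
  by apply/eqP => x00; move: q0; rewrite x00 rdot0r ltxx.
have supE : has_sup E.
  split; first by exists (rdot (T x0) x0 / rnorm x0 ^+ 2); exact: unitE.
  exists c => _ [x /= nx <-]; rewrite (le_trans (cauchy_schwarz _ _)) //.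
  by rewrite nx mulr1 (le_trans (Tc x)) // nx mulr1.
pose l := sup E.
have Tl x : rdot (T x) x <= l * rnorm x ^+ 2.
  have [->|xN0] := eqVneq x 0; first by rewrite -rdotxx !rdot0r mulr0.
  rewrite -ler_pdivrMr; first exact/(sup_upper_bound supE)/unitE.
  by rewrite exprn_gt0 // lt_def rnorm_eq0 xN0 rnorm_ge0.
have l0 : 0 < l.
  have n0 : 0 < rnorm x0 ^+ 2 by rewrite exprn_gt0 // lt_def rnorm_eq0 x0N0 rnorm_ge0.
  by rewrite -(pmulr_lgt0 _ n0) (lt_le_trans q0).
exists l => // d d0; pose W x := l%:C%C *: x - T x.
have bW : bounded_operator W.
  exact: (bounded_sub (bounded_scale l%:C%C (@bounded_id R H)) bT).
have saW : selfadjoint W.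
  by move=> x y; rewrite /W rdotBl rdotBr rdotZl rdotZr saT.
have WE x : rdot (W x) x = l * rnorm x ^+ 2 - rdot (T x) x.
  by rewrite /W rdotBl rdotZl rdotxx.
have W0 x : 0 <= rdot (W x) x by rewrite WE subr_ge0.
have [k k0 Wk] := rnorm_positive_le bW saW W0.
(* The gap to the supremum for which [rnorm (W x) ^+ 2 <= k * rdot (W x) x] yields
   [rnorm (W x) <= d]. *)
have dk0 : 0 < d ^+ 2 / k by rewrite divr_gt0 ?exprn_gt0.
have [_ [x /= nx <-] lx] := sup_adherent dk0 supE.
exists x => //; rewrite -[T x - _]opprB rnormN -/(W x).
rewrite -(@ler_pXn2r _ 2) ?nnegrE ?rnorm_ge0 ?(ltW d0) // (le_trans (Wk x)) //.
rewrite mulrC -ler_pdivlMr // WE nx expr1n mulr1.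
by rewrite lerBlDr addrC -lerBlDr ltW.
Qed.

(* Operator monotonicity of the square root: at an approximate eigenvector [x]
   of [S - T] with eigenvalue [l > 0], [S x] is close to [T x + l *: x], which is
   strictly longer than [T x]. *)
Lemma le_of_rnorm_le S T : bounded_operator S -> bounded_operator T ->
  positive_operator S -> positive_operator T ->
  (forall x, rnorm (S x) <= rnorm (T x)) ->
  forall x, rdot (S x) x <= rdot (T x) x.
Proof.
move=> bS bT posS posT ST x0; rewrite leNgt; apply/negP => lt0.
have saS := positive_selfadjoint (bounded_linear bS) posS.
have saT := positive_selfadjoint (bounded_linear bT) posT.
have saD : selfadjoint (S - T).
  by move=> x y; rewrite rdotBl rdotBr saS saT.
have D0 : 0 < rdot ((S - T) x0) x0 by rewrite rdotBl subr_gt0.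
have [l l0 app] := approximate_eigenvector (bounded_sub bS bT) saD D0.
have [c c0 Tc] := bounded_rnorm bT.
(* With this [d], the triangle inequality lets the square exceed [rnorm (T x) ^+ 2] by at most
   [2 * c * d + d ^+ 2 < l ^+ 2], whereas its expansion exceeds it by at least [l ^+ 2]. *)
pose d := l ^+ 2 / (2 * c + 2 * l).
have cl0 : 0 < 2 * c + 2 * l by lra.
have d0 : 0 < d by rewrite divr_gt0 ?exprn_gt0.
have dE : d * (2 * c + 2 * l) = l ^+ 2 by rewrite /d divfK // gt_eqF.
have [x nx Dx] := app d d0.
have Tx : rnorm (T x) <= c by rewrite (le_trans (Tc x)) // nx mulr1.
have le_d : rnorm (T x + l%:C%C *: x) <= rnorm (T x) + d.
  have -> : T x + l%:C%C *: x = S x - ((S - T) x - l%:C%C *: x).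
    by rewrite -[(S - T) x]/(S x - T x) !opprB [RHS]addrC addrA subrK addrC.
  by rewrite (le_trans (rnormD _ _)) // rnormN lerD.
have : rnorm (T x + l%:C%C *: x) ^+ 2 = rnorm (T x) ^+ 2 + 2 * l * rdot (T x) x + l ^+ 2.
  rewrite -rdotxx !(rdotDl, rdotDr, rdotZl, rdotZr) [rdot x (T x)]rdotC !rdotxx nx.
  by ring.
have := positive_rdot x posT; have := rnorm_ge0 (T x).
have := rnorm_ge0 (T x + l%:C%C *: x); move: le_d Tx dE.
move: (rnorm _) (rnorm (T x)) (rdot _ _) => u t w le_d tc dE u0 t0 w0 uE.
have lw0 : 0 <= l * w by rewrite mulr_ge0 // ltW.
have u2 : u ^+ 2 <= (t + d) ^+ 2.
  by rewrite ler_pXn2r ?nnegrE // addr_ge0 // ltW.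
have td : t * d <= c * d by rewrite ler_wpM2r // ltW.
have dl : 0 < d * l by rewrite mulr_gt0.
have dd : d * d <= d * l.
  rewrite ler_wpM2l ?(ltW d0) // /d ler_pdivrMr // expr2 ler_wpM2l ?(ltW l0) //.
  by lra.
by nra.
Qed.

Lemma positive_add S T : positive_operator S -> positive_operator T ->
  positive_operator (S + T).
Proof.
move=> posS posT x; rewrite -[(S + T) x]/(S x + T x) linearDl.
by apply: addr_ge0; [exact: posS|exact: posT].
Qed.

(** By commutation [4 * rnorm (S z) ^+ 2 = 4 * rdot (A z) (B z)], which is [rnorm (A z + B z) ^+ 2 -
    rnorm (A z - B z) ^+ 2]. So [le_of_rnorm_le] applies to [S + S] and [A + B]. *)
Lemma commuting_sqrt_le_mean A B S : bounded_operator A -> bounded_operator B ->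
  positive_operator A -> positive_operator B -> A \o B = B \o A ->
  is_sqrt (A \o B) S ->
  forall x, 2 * rdot (S x) x <= rdot (A x) x + rdot (B x) x.
Proof.
move=> bA bB posA posB AB [bS posS SS] x.
have saA := positive_selfadjoint (bounded_linear bA) posA.
have saB := positive_selfadjoint (bounded_linear bB) posB.
have saS := positive_selfadjoint (bounded_linear bS) posS.
have SAB z : rnorm ((S + S) z) <= rnorm ((A + B) z).
  rewrite -[(A + B) z]/(A z + B z) -[(S + S) z]/(S z + S z).
  rewrite -(@ler_pXn2r _ 2) ?nnegrE ?rnorm_ge0 // -!rdotxx -subr_ge0.
  have SE : rdot (S z) (S z) = rdot (A z) (B z).
    by rewrite -saS -[S (S z)]/((S \o S) z) SS AB /= saB.
  suff -> : rdot (A z + B z) (A z + B z) - rdot (S z + S z) (S z + S z) =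
      rdot (A z - B z) (A z - B z) by rewrite rdotxx sqr_ge0.
  rewrite !(rdotBl, rdotBr, rdotDl, rdotDr) SE [rdot (B z) (A z)]rdotC.
  by ring.
have := le_of_rnorm_le (bounded_add bS bS) (bounded_add bA bB)
  (positive_add posS posS) (positive_add posA posB) SAB x.
by rewrite -[(A + B) x]/(A x + B x) -[(S + S) x]/(S x + S x) !rdotDl; lra.
Qed.

End OrderOfOperators.

(** * Inverses of coercive operators *)

Section Inverse.
Variables (R : realType) (H : hilbertType R).
Implicit Types (x y z : H) (a c : R) (S T P : H -> H).

(** The index provided is also large against [e^-1], so that an error of [n.+1%:R^-1] is below [e]
    at the same [n]. *)
Lemma rnorm_complete (u : nat -> H) :
  (forall e : R, 0 < e -> exists N, forall n m, (N <= n)%N -> (N <= m)%N ->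
     rnorm (u n - u m) < e) ->
  exists l, forall e : R, 0 < e -> exists2 n, (1 < e * n.+1%:R) & rnorm (l - u n) < e.
Proof.
move=> cauchy_u.
have posE (e : R[i]) : 0 < e -> 0 < complex.Re e /\ e = (complex.Re e)%:C%C.
  by case: e => er ei; rewrite ltcE /= => /andP[/eqP -> er0].
have /cvg_ex[l ul] : cvg (u @ \oo).
  apply/cauchy_cvgP/cauchy_ballP => e /posE[e0 ->].
  have [N uN] := cauchy_u _ e0.
  near_simpl; exists ([set n | N <= n]%N, [set n | N <= n]%N); first by split; exists N.
  move=> [n m] [/= Nn Nm]; rewrite -ball_normE /= rnormE ltcR.
  exact: uN.
exists l => e e0; have eC0 : 0 < e%:C%C by rewrite ltcR.
have /cvgrPdist_lt/(_ _ eC0)[N _ uN] := ul.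
exists (maxn N (Num.truncn e^-1)); last first.
  by have := uN (maxn N (Num.truncn e^-1)) (leq_maxl _ _); rewrite rnormE ltcR.
rewrite mulrC -ltr_pdivrMr // div1r (lt_le_trans (truncnS_gt _)) //.
by rewrite ler_nat ltnS leq_maxr.
Qed.

Lemma coercive_bounded_below P c : (forall x, c * rnorm x ^+ 2 <= rdot (P x) x) ->
  forall x, c * rnorm x <= rnorm (P x).
Proof.
move=> Pc x; have [->|x0] := eqVneq x 0.
  have /eqP -> : rnorm (0 : H) == 0 by rewrite rnorm_eq0.
  by rewrite mulr0 rnorm_ge0.
have n0 : 0 < rnorm x by rewrite lt_def rnorm_eq0 x0 rnorm_ge0.
rewrite -(ler_pM2r n0) -mulrA -expr2 (le_trans (Pc x)) //.
exact: cauchy_schwarz.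
Qed.

(* With [t] small, [1 - t P] is a strict contraction, so its iterates send the
   residual of [P x = y] to [0]. *)
Lemma coercive_dense_range P c y : bounded_operator P -> 0 < c ->
  (forall x, c * rnorm x ^+ 2 <= rdot (P x) x) ->
  forall e : R, 0 < e -> exists x, rnorm (y - P x) < e.
Proof.
move=> bP c0 Pc e e0; have linP := bounded_linear bP.
have [d d0 Pd] := bounded_rnorm bP.
(* [C] bounds [P] and exceeds [c], whence [0 <= q]. Since [t * C ^+ 2 = c], the factor
   [1 - 2 * t * c + t ^+ 2 * C ^+ 2] of one iteration is exactly [q]. *)
pose C := c + d; pose t := c / C ^+ 2; pose q := 1 - t * c.
have C0 : 0 < C by rewrite addr_gt0.
have PC x : rnorm (P x) ^+ 2 <= C ^+ 2 * rnorm x ^+ 2.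
  rewrite -exprMn ler_pXn2r ?nnegrE ?mulr_ge0 ?rnorm_ge0 ?(ltW C0) //.
  by rewrite (le_trans (Pd x)) // ler_wpM2r ?rnorm_ge0 // lerDr ltW.
have t0 : 0 < t by rewrite divr_gt0 ?exprn_gt0.
have tC : t * C ^+ 2 = c by rewrite divfK // gt_eqF ?exprn_gt0.
have q0 : 0 <= q.
  rewrite subr_ge0 /t mulrAC ler_pdivrMr ?exprn_gt0 // mul1r -expr2.
  by rewrite ler_pXn2r ?nnegrE ?(ltW c0) ?(ltW C0) // lerDl ltW.
have q1 : q < 1 by rewrite ltrBlDr ltrDl mulr_gt0.
have step r : rnorm (r - t%:C%C *: P r) ^+ 2 <= q * rnorm r ^+ 2.
  rewrite -rdotxx !(rdotBl, rdotBr, rdotZl, rdotZr) [rdot r (P r)]rdotC !rdotxx.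
  have le1 : t * (c * rnorm r ^+ 2) <= t * rdot (P r) r by rewrite ler_pM2l.
  have : t * (t * rnorm (P r) ^+ 2) <= t * (t * (C ^+ 2 * rnorm r ^+ 2)).
    by rewrite !ler_pM2l.
  rewrite [t * (C ^+ 2 * _)]mulrA tC => le2.
  rewrite /q; move: le1 le2; move: (rdot _ _) (_ ^+ 2) (_ ^+ 2) => v w z.
  by nra.
have iter_step n : exists x, rnorm (y - P x) ^+ 2 <= q ^+ n * rnorm y ^+ 2.
  elim: n => [|n [x xn]]; first by exists 0; rewrite linear_op0 // subr0 mul1r.
  (* The residual of this vector is [1 - t P] applied to the residual of [x]. *)
  exists (x + t%:C%C *: (y - P x)).
  rewrite (linear_opD _ _ linP) (linear_opZ _ _ linP) opprD addrA.
  rewrite (le_trans (step _)) // [q ^+ n.+1]exprS -mulrA.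
  by rewrite ler_wpM2l.
(* The added [1] keeps the denominator positive when [y = 0]. *)
have eps0 : 0 < e ^+ 2 / (rnorm y ^+ 2 + 1).
  by rewrite divr_gt0 ?exprn_gt0 // ltr_wpDl // sqr_ge0.
have /cvg_expr/cvgrPdist_lt/(_ _ eps0)[N _ qN] : `|q| < 1 by rewrite ger0_norm.
have [x xN] := iter_step N; exists x.
have := qN N (leqnn N); rewrite sub0r normrN ger0_norm ?exprn_ge0 // => qNe.
rewrite -(@ltr_pXn2r _ 2) ?nnegrE ?rnorm_ge0 ?(ltW e0) // (le_lt_trans xN) //.
have y1 : 0 < rnorm y ^+ 2 + 1 by rewrite ltr_wpDl // sqr_ge0.
move: qNe; rewrite ltr_pdivlMr // => /(le_lt_trans _); apply.
by rewrite ler_wpM2l ?exprn_ge0 // lerDl.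
Qed.

(** Approximate solutions with residual below [n.+1%:R^-1] form a Cauchy sequence because [P] is
    bounded below, and continuity of [P] identifies the image of the limit. *)
Lemma coercive_surjective P c y : bounded_operator P -> 0 < c ->
  (forall x, c * rnorm x ^+ 2 <= rdot (P x) x) -> exists x, P x = y.
Proof.
move=> bP c0 Pc; have linP := bounded_linear bP.
have Pbelow := coercive_bounded_below Pc.
have /choice[u uP] : forall n : nat, exists x, rnorm (y - P x) < n.+1%:R^-1.
  by move=> n; apply: (coercive_dense_range y bP c0 Pc); rewrite invr_gt0.
have uinv n N : (N <= n)%N -> rnorm (y - P (u n)) < N.+1%:R^-1.
  by move=> Nn; rewrite (lt_le_trans (uP n)) // lef_pV2 ?posrE // ler_nat.
have [|l lP] := @rnorm_complete u.
  (* Past this index two residuals add up to less than [c * e]. *)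
  move=> e e0; pose N := Num.truncn (2 / (c * e)).
  have N0 : N.+1%:R^-1 < c * e / 2.
    rewrite -[ltRHS]invrK ltf_pV2 ?posrE ?invr_gt0 ?divr_gt0 ?mulr_gt0 //.
    by rewrite invf_div truncnS_gt.
  exists N => n m Nn Nm; rewrite -(ltr_pM2l c0) (le_lt_trans (Pbelow _)) //.
  have -> : P (u n - u m) = (y - P (u m)) - (y - P (u n)).
    by rewrite linear_opB // opprB [RHS]addrC addrA subrK.
  rewrite (le_lt_trans (rnormD _ _)) // rnormN [ltRHS]splitr.
  by rewrite ltrD // (lt_trans _ N0) // uinv.
exists l; apply/esym/eqP; rewrite -subr_eq0 -rnorm_eq0 eq_le rnorm_ge0 andbT.
have [d d0 Pd] := bounded_rnorm bP.
apply/ler_addgt0Pl => e e0; rewrite addr0.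
(* One share [e / (1 + d)] covers the residual of [u n], and [d] shares cover [P (l - u n)]. *)
have ed0 : 0 < e / (1 + d) by rewrite divr_gt0 // addr_gt0.
have [n n1 ln] := lP _ ed0.
have -> : y - P l = (y - P (u n)) - P (l - u n).
  by rewrite linear_opB // opprB addrA subrK.
rewrite (le_trans (rnormD _ _)) // rnormN.
have -> : e = e / (1 + d) + d * (e / (1 + d)) by field; rewrite gt_eqF // addr_gt0.
rewrite lerD //; last by rewrite (le_trans (Pd _)) // ler_wpM2l // ltW.
rewrite (le_trans (ltW (uP n))) // -div1r ler_pdivrMr //.
exact: ltW.
Qed.

(** This is the Lax-Milgram theorem; the lower bound that makes [P] injective also bounds the
    inverse by [c^-1]. *)
Lemma coercive_inverse P c : bounded_operator P -> 0 < c ->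
  (forall x, c * rnorm x ^+ 2 <= rdot (P x) x) ->
  exists Q, [/\ bounded_operator Q, Q \o P = idfun & P \o Q = idfun].
Proof.
move=> bP c0 Pc; have linP := bounded_linear bP.
have Pbelow := coercive_bounded_below Pc.
have Pinj : injective P.
  move=> x y Pxy; apply/eqP; rewrite -subr_eq0 -rnorm_eq0 eq_le rnorm_ge0 andbT.
  rewrite -(ler_pM2l c0) mulr0 (le_trans (Pbelow _)) // linear_opB // Pxy subrr.
  by rewrite le_eqVlt rnorm_eq0 eqxx.
have /choice[Q QP] : forall y, exists x, P x = y.
  by move=> y; apply: coercive_surjective c0 Pc.
exists Q; split; last by apply/funext => x /=.
  apply: (@rnorm_bounded _ _ _ c^-1) => [k x y|x].
    by apply: Pinj; rewrite linP !QP.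
  by rewrite mulrC ler_pdivlMr // mulrC -{2}[x]QP.
by apply/funext => x; apply: Pinj => /=.
Qed.

End Inverse.

(** * Closure properties of von Neumann algebras, and adjoints *)

Section VonNeumannAlgebras.
Variables (R : realType) (H : hilbertType R).
Implicit Types (S T U : H -> H) (M : set (H -> H)).

Lemma vna_commute M T U : von_neumann_algebra M -> M T -> commutant M U ->
  T \o U = U \o T.
Proof. by move=> vM MT [_ UM]; rewrite UM. Qed.

(** The bicommutant condition as a membership test; sums, products and inverses all enter the
    algebra through it. *)
Lemma vna_mem M T : von_neumann_algebra M -> bounded_operator T ->
  (forall U, commutant M U -> T \o U = U \o T) -> M T.
Proof. by move=> vM bT TM; rewrite -(vna_bicommutant vM); split. Qed.

Lemma vna_id M : von_neumann_algebra M -> M idfun.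
Proof. by move=> vM; apply: vna_mem => //; exact: bounded_id. Qed.

Lemma vna_comp M S T : von_neumann_algebra M -> M S -> M T -> M (S \o T).
Proof.
move=> vM MS MT; apply: vna_mem => // [|U UM].
  by apply: bounded_comp; apply: vna_bounded vM _ _.
by rewrite -compA (vna_commute vM MT UM) compA (vna_commute vM MS UM).
Qed.

Lemma vna_lincomb M k S T : von_neumann_algebra M -> M S -> M T ->
  M (k *: S + T).
Proof.
move=> vM MS MT; apply: vna_mem => // [|U UM].
  by apply: bounded_lincomb; apply: vna_bounded vM _ _.
have linU := bounded_linear UM.1; apply/funext => x.
change (k *: S (U x) + T (U x) = U (k *: S x + T x)).
rewrite linU -[S (U x)]/((S \o U) x) -[T (U x)]/((T \o U) x).
by rewrite (vna_commute vM MS UM) (vna_commute vM MT UM).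
Qed.

Lemma is_adjointC S T : is_adjoint S T -> is_adjoint T S.
Proof.
move=> ST x y; rewrite hermC [RHS]hermC; congr (_ * Num.conj _).
exact: esym (ST y x).
Qed.

Lemma is_adjoint_id : is_adjoint (@idfun H) idfun.
Proof. by []. Qed.

Lemma rdot_adjoint S T x y : is_adjoint S T -> rdot (S x) y = rdot x (T y).
Proof. by move=> ST; rewrite /rdot ST. Qed.

End VonNeumannAlgebras.

(** * Unitality and order reflection of star isomorphisms *)

Section StarIsomorphism.
Variables (R : realType) (H K : hilbertType R).
Variables (M : set (H -> H)) (N : set (K -> K)) (pi : (H -> H) -> (K -> K)).
Hypotheses (vM : von_neumann_algebra M) (vN : von_neumann_algebra N).
Hypothesis iso_pi : star_isomorphism M N pi.

Lemma iso_mem T : M T -> N (pi T).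
Proof. by move=> MT; rewrite -(iso_image iso_pi); exists T. Qed.

(** The identity of [K] is [pi e] for some [e] in [M], and [pi idfun \o pi e = pi e] by
    multiplicativity. *)
Lemma iso_id : pi idfun = idfun.
Proof.
have : N idfun by exact: vna_id.
rewrite -(iso_image iso_pi) => -[e Me pe].
by rewrite -[LHS]/(pi idfun \o idfun) -pe -(iso_mul iso_pi) //; exact: vna_id.
Qed.

(* If [T] were not positive, [l + T] would be non-invertible for some [l > 0],
   although its image is invertible, with inverse in [N] by the bicommutant
   condition. *)
Lemma iso_reflects_positive T : M T -> selfadjoint T ->
  (forall z, 0 <= rdot (pi T z) z) -> forall x, 0 <= rdot (T x) x.
Proof.
move=> MT saT posT x0; rewrite leNgt; apply/negP => neg.
have bT := vna_bounded vM MT; have Mid := vna_id vM.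
(* For [- T], approximate eigenvectors at [l] are unit vectors nearly killed by [l + T]. *)
have [] := @approximate_eigenvector _ _ ((-1) *: T) x0.
- exact: bounded_scale.
- by move=> x y; rewrite -[LHS]/(rdot (-1 *: T x) y) -[RHS]/(rdot x (-1 *: T y))
    !scaleN1r -[- T x]sub0r -[- T y]sub0r rdotBl rdotBr rdot0l rdot0r saT.
- rewrite -[X in rdot X]/(-1 *: T x0) scaleN1r -[- T x0]sub0r rdotBl rdot0l.
  by rewrite sub0r oppr_gt0.
move=> l l0 app; pose W : H -> H := l%:C%C *: idfun + T.
have MW : M W by exact: vna_lincomb.
have piW z : pi W z = l%:C%C *: z + pi T z.
  by rewrite /W (iso_linear iso_pi) // iso_id.
have [||Q [bQ QW WQ]] := @coercive_inverse _ _ (pi W) l _ l0.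
- exact/(vna_bounded vN)/iso_mem.
- by move=> z; rewrite piW rdotDl rdotZl rdotxx lerDl.
(* For [U] in the commutant, [Q U = Q U (pi W) Q = Q (pi W) U Q = U Q]. *)
have NQ : N Q.
  apply: vna_mem => // U UN.
  rewrite -[LHS]compA -[U in LHS]/(idfun \o U).
  have -> : Q \o U = Q \o U \o (pi W \o Q) by rewrite WQ.
  rewrite -[LHS]/(Q \o (U \o pi W) \o Q) -(vna_commute vN (iso_mem MW) UN).
  by rewrite -[LHS]/((Q \o pi W) \o U \o Q) QW.
move: NQ; rewrite -(iso_image iso_pi) => -[Y MY YQ].
have YW : Y \o W = idfun.
  apply: (iso_inj iso_pi (vna_comp vM MY MW) Mid).
  by rewrite (iso_mul iso_pi MY MW) YQ QW iso_id.
(* The left inverse [Y] forces [rnorm (W x) >= c^-1] at unit vectors, so the tolerance [c^-1 / 2] is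
   contradictory. *)
have [c c0 Yc] := bounded_rnorm (vna_bounded vM MY).
have [|x nx Wx] := app (c^-1 / 2); first by rewrite divr_gt0 ?invr_gt0.
have {}Wx : rnorm (W x) <= c^-1 / 2.
  rewrite -rnormN (le_trans _ Wx) // -[W x]/(l%:C%C *: x + T x).
  by rewrite -[X in rnorm (X - _)]/(-1 *: T x) scaleN1r opprD addrC.
have : rnorm x <= 1 / 2.
  rewrite -[x in leLHS]/(idfun x) -YW (le_trans (Yc _)) //.
  by rewrite -ler_pdivlMl // div1r.
by rewrite nx; lra.
Qed.

End StarIsomorphism.

(** * Geometric means of positive forms *)

Lemma geometric_mean_kernel (R : realType) (V : lmodType R[i])
    (a b c : V -> V -> R[i]) v w : is_form_geometric_mean a b c ->
  a v v = 0 -> complex.Re (c v w) = 0 /\ complex.Re (c w v) = 0.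
Proof.
move=> [K [h [A [B [S [rep [bS posS SS] cS]]]]]] avv.
have saS := positive_selfadjoint (bounded_linear bS) posS.
have Av0 : A (h v) = 0.
  apply: positive_eq0 (cr_boundedA rep) (cr_positiveA rep) _.
  by rewrite /rdot -(cr_formA rep) avv.
(* As [A] and [B] commute, [rnorm (S (h v)) ^+ 2] equals [rdot (B (A (h v))) (h v)]. *)
have Sv0 : S (h v) = 0.
  apply/eqP; rewrite -rnorm_eq0 -sqrf_eq0 -rdotxx -saS.
  rewrite -[S (S _)]/((S \o S) _) SS (cr_commute rep) /= Av0.
  by rewrite linear_op0 ?rdot0l //; exact: bounded_linear (cr_boundedB rep).
rewrite !cS; split; first by rewrite Sv0 -[LHS]/(rdot _ _) rdot0l.
by rewrite -[LHS]/(rdot _ _) saS Sv0 rdot0r.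
Qed.

Lemma geometric_mean_le (R : realType) (V : lmodType R[i])
    (a b c : V -> V -> R[i]) v : is_form_geometric_mean a b c ->
  2 * complex.Re (c v v) <= complex.Re (a v v) + complex.Re (b v v).
Proof.
move=> [K [h [A [B [S [rep sqrtS cS]]]]]].
rewrite cS (cr_formA rep) (cr_formB rep).
exact: (commuting_sqrt_le_mean (cr_boundedA rep) (cr_boundedB rep)
  (cr_positiveA rep) (cr_positiveB rep) (cr_commute rep) sqrtS).
Qed.

(** * Completely positive maps and their geometric means *)

Lemma cp_positive_id (R : realType) (H K : hilbertType R) (M : set (H -> H))
    (N : set (K -> K)) (Phi : (H -> H) -> (K -> K)) :
  von_neumann_algebra M -> completely_positive M N Phi ->
  positive_operator (Phi idfun).
Proof.
(* Ordinary positivity is the case of 1 x 1 matrices. *)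
move=> vM cpPhi x; pose X : 'M[H -> H]_1 := const_mx idfun.
have MX i j : M (X i j) by rewrite mxE; exact: vna_id.
have posX : positive_opmx X.
  by move=> xi; rewrite !big_ord1 mxE inner_norm exprn_ge0.
by have := cp_positive cpPhi MX posX (fun=> x); rewrite !big_ord1 !mxE.
Qed.

Section GeometricMeanOfCPMaps.
Variables (R : realType) (H L : hilbertType R).
Variables (M : set (H -> H)) (N : set (L -> L)) (pi : (H -> H) -> (L -> L)).
Hypotheses (vM : von_neumann_algebra M) (vN : von_neumann_algebra N).
Hypothesis iso_pi : star_isomorphism M N pi.
Implicit Types (Phi Psi Theta : (H -> H) -> (H -> H)) (a b x y : H -> H).

Lemma pi_eq S T : M S -> M T ->
  (forall xi eta, rdot (pi S xi) eta = rdot (pi T xi) eta) -> S = T.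
Proof.
move=> MS MT ST; apply: (iso_inj iso_pi) => //; apply/funext => xi.
exact: rdot_eq.
Qed.

Section FormKernel.
Variables (V : lmodType R[i]) (t : (H -> H) -> L -> V).

(** Paired with [t y eta], where [y] has adjoint [z], the vector gives [pi (Phi (z x a)) xi - pi
    (Phi (z x)) (pi a xi) = 0]. It is itself a difference of two such tensors. *)
Lemma cp_form_tensor_kernel Phi (s : sesquilinear R V) a x xi :
  is_cp_form M pi t Phi s -> (forall y, M y -> M (Phi y)) ->
  M a -> (forall y, M y -> Phi (y \o a) = Phi y \o a) -> M x ->
  s (t (x \o a) xi - t x (pi a xi)) (t (x \o a) xi - t x (pi a xi)) = 0.
Proof.
move=> [_ sE] MPhi Ma Phia Mx; have Mxa := vna_comp vM Mx Ma.
have s0 y eta : M y -> s (t (x \o a) xi - t x (pi a xi)) (t y eta) = 0.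
  move=> My; have [z Mz yz] := vna_adjoint vM My.
  rewrite linearBl (sE _ _ _ _ _ Mxa My yz) (sE _ _ _ _ _ Mx My yz).
  rewrite -[z \o (x \o a)]/((z \o x) \o a) Phia; last exact: vna_comp.
  by rewrite (iso_mul iso_pi) ?subrr //; apply: MPhi; exact: vna_comp.
by rewrite linearBr !s0 ?subrr.
Qed.

End FormKernel.

(** Operators in the second variable of the form enter through their adjoints. A kernel vector in
    the first variable therefore gives the right module identity for [a], and one in the second
    variable the left identity for [d]. *)
Lemma geometric_mean_bimodule Phi Psi Theta a d x :
  is_cp_geometric_mean M M pi Phi Psi Theta ->
  (forall y, M y -> M (Phi y)) -> M a ->
  (forall y, M y -> Phi (y \o a) = Phi y \o a) -> is_adjoint a d -> M d -> M x ->
  Theta (x \o a) = Theta x \o a /\ Theta (d \o x) = d \o Theta x.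
Proof.
move=> [cpT [V [t [s1 [s2 [s [_ s1P _ gm [_ sE]]]]]]]] MPhi Ma Phia ad Md Mx.
have Mid := vna_id vM; have MT y : M y -> M (Theta y) by exact: cp_maps cpT _.
have Mxa := vna_comp vM Mx Ma; have Mdx := vna_comp vM Md Mx.
have idad := @is_adjoint_id R H.
split; apply: pi_eq => [||xi eta].
- exact: MT.
- by apply: vna_comp => //; exact: MT.
- have [+ _] := geometric_mean_kernel (t idfun eta) gm
    (cp_form_tensor_kernel xi s1P MPhi Ma Phia Mx).
  rewrite linearBl (sE _ _ _ _ _ Mxa Mid idad) (sE _ _ _ _ _ Mx Mid idad).
  rewrite raddfB => /subr0_eq.
  by rewrite (iso_mul iso_pi) //; exact: MT.
- exact: MT.
- by apply: vna_comp => //; exact: MT.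
(* The kernel vector is now [a (x) eta - 1 (x) a eta], paired with [x (x) xi]. *)
have [_] := geometric_mean_kernel (t x xi) gm
  (cp_form_tensor_kernel eta s1P MPhi Ma Phia Mid).
rewrite linearBr (sE _ _ _ _ _ Mx Ma ad) (sE _ _ _ _ _ Mx Mid idad).
rewrite raddfB => /subr0_eq.
rewrite (iso_mul iso_pi) //; last exact: MT.
have da := is_adjointC (iso_adjoint iso_pi Ma Md ad).
move=> sdx; rewrite -[RHS]/(rdot (pi d (pi (Theta x) xi)) eta).
by rewrite (rdot_adjoint _ _ da).
Qed.

Lemma geometric_mean_subunital Phi Psi Theta :
  is_cp_geometric_mean M M pi Phi Psi Theta ->
  Phi idfun = idfun -> Psi idfun = idfun -> operator_le (Theta idfun) idfun.
Proof.
move=> [cpT [V [t [s1 [s2 [s [_ [_ s1E] [_ s2E] gm [_ sE]]]]]]]] Phi1 Psi1.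
have Mid := vna_id vM; have MT : M (Theta idfun) by exact: cp_maps cpT _ Mid.
have posT := cp_positive_id vM cpT.
have saT := positive_selfadjoint (bounded_linear (vna_bounded vM MT)) posT.
have idad := @is_adjoint_id R H.
(* [1 - Theta 1], in the shape that [vna_lincomb] and [iso_linear] expect. *)
have M1T : M ((-1) *: Theta idfun + idfun) by exact: vna_lincomb.
have opE (K : hilbertType R) (T : K -> K) z : ((-1) *: T + idfun) z = z - T z.
  by rewrite -[LHS]/(-1 *: T z + z) scaleN1r addrC.
have sa1T : selfadjoint ((-1) *: Theta idfun + idfun).
  by move=> y z; rewrite !opE rdotBl rdotBr saT.
have pos1T := iso_reflects_positive vM vN iso_pi M1T sa1T.
move=> x; rewrite -[(idfun - _) x]/(x - Theta idfun x) linearBl.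
(* The order on [R[i]] also compares imaginary parts, so both must be seen to vanish. *)
have ImT : complex.Im (inner (Theta idfun x) x) = 0 by apply: ger0_Im; exact: posT.
have Im1 : complex.Im (inner x x) = 0 by apply: ger0_Im; rewrite inner_norm exprn_ge0.
rewrite lecE raddfB [X in _ && (_ <= X)]raddfB /= ImT Im1 subrr eqxx /=.
have := pos1T _ x; rewrite opE rdotBl; apply=> z.
rewrite (iso_linear iso_pi) // (iso_id vM vN iso_pi) opE rdotBl subr_ge0.
(* At [1 (x) z] the forms of [Phi] and [Psi] both have real part [rdot z z]. *)
have := geometric_mean_le (t idfun z) gm.
rewrite (sE _ _ _ _ _ Mid Mid idad) (s1E _ _ _ _ _ Mid Mid idad).
rewrite (s2E _ _ _ _ _ Mid Mid idad) -![complex.Re _]/(rdot _ _).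
rewrite -[idfun \o idfun]/(@idfun H) Phi1 Psi1 (iso_id vM vN iso_pi).
by rewrite /=; lra.
Qed.

End GeometricMeanOfCPMaps.

Theorem proposition5p2 (R : realType) (H : hilbertType R)
    (M N1 N2 : set (H -> H)) (E1 E2 : (H -> H) -> (H -> H))
    (L : hilbertType R) (pi : (H -> H) -> (L -> L))
    (Theta : (H -> H) -> (H -> H)) :
  von_neumann_algebra M ->
  von_neumann_algebra N1 -> N1 `<=` M ->
  von_neumann_algebra N2 -> N2 `<=` M ->
  conditional_expectation M N1 E1 ->
  conditional_expectation M N2 E2 ->
  standard_representation M pi ->
  is_cp_geometric_mean M M pi E1 E2 Theta ->
  (forall a x b, (N1 `&` N2) a -> M x -> (N1 `&` N2) b ->
     Theta (a \o x \o b) = a \o Theta x \o b) /\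
  (operator_le (Theta idfun) idfun /\
   (commutant (N1 `&` N2) `&` M) (Theta idfun)).
Proof.
move=> vM vN1 N1M vN2 N2M ceE1 ceE2 [N [J [P [vN iso_pi _]]]] gm.
have Mid := vna_id vM.
have MT : M (Theta idfun) by exact: cp_maps gm.1 _ Mid.
have ME1 y : M y -> M (E1 y) by move=> My; apply/N1M/(cp_maps (ce_cp ceE1)).
have E1a a : N1 a -> forall y, M y -> E1 (y \o a) = E1 y \o a.
  by move=> N1a y My; exact: (ce_bimodule ceE1 (vna_id vN1) My N1a).
have Theta_mod a x : N1 a -> M x ->
    Theta (x \o a) = Theta x \o a /\ Theta (a \o x) = a \o Theta x.
  (* The left identity for [a] comes from the right module property of [E1] at the adjoint [d],
     again in [N1]. *)
  move=> N1a Mx; have [d N1d ad] := vna_adjoint vN1 N1a; split.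
    exact: (geometric_mean_bimodule vM iso_pi gm ME1 (N1M _ N1a) (E1a _ N1a)
      ad (N1M _ N1d) Mx).1.
  exact: (geometric_mean_bimodule vM iso_pi gm ME1 (N1M _ N1d) (E1a _ N1d)
    (is_adjointC ad) (N1M _ N1a) Mx).2.
split=> [a x b [N1a _] Mx [N1b _]|].
  rewrite (Theta_mod b _ N1b (vna_comp vM (N1M _ N1a) Mx)).1.
  by rewrite (Theta_mod a _ N1a Mx).2.
split; last split=> //.
  by apply: (geometric_mean_subunital vM vN iso_pi gm);
    [apply: (ce_id ceE1) | apply: (ce_id ceE2)]; exact: vna_id.
split=> [|a [N1a _]]; first exact: vna_bounded vM _ MT.
(* Both [idfun \o a] and [a \o idfun] are [a], so the two module identities meet at [Theta a]. *)
by have [<- <-] := Theta_mod a _ N1a Mid.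
Qed.
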